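(* Let $\langle R,\sim\rangle$ be the Rado graph, $L\in\mathbb P(R)$, $\mathcal L_L=\langle\{L_n:n\in\omega\},\{q^{\bigcup_{i<n}L_i}_K:n\in\omega,K\subset\bigcup_{i<n}L_i\}\rangle$ a labeling of $L$, $\le_L$ the corresponding reversed tree order on $L$, and $\mathcal S$ a strong reversed subtree of $\langle L,\le_L\rangle$. Then there is a copy $\Lambda\in\mathbb P(R)$ with $\Lambda\subset\mathcal S$ and a labeling $\mathcal L_\Lambda=\langle\{\Lambda_k:k\in\omega\},\{p^{\bigcup_{j<k}\Lambda_j}_H:k\in\omega,H\subset\bigcup_{j<k}\Lambda_j\}\rangle$ of $\Lambda$ such that the orders $\le_\Lambda$ and $\le_L$ coincide on $\Lambda$ and for all $k\in\omega$ and $H\subset\bigcup_{j<k}\Lambda_j$, $$\Lambda^{\bigcup_{j<k}\Lambda_j}_H=(-\infty,p^{\bigcup_{j<k}\Lambda_j}_H]_{\langle\Lambda,\le_\Lambda\rangle}=\Lambda\cap(-\infty,p^{\bigcup_{j<k}\Lambda_j}_H]_{\langle L,\le_L\rangle}.$$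
   Context: The Rado graph $\langle R,\sim\rangle$ is the unique countable graph such that $R^H_K\neq\emptyset$ for all finite $K\subset H\subset R$, where $R^H_K=\{v\in R\setminus H:\forall k\in K\,(v\sim k)\wedge\forall h\in H\setminus K\,(v\not\sim h)\}$; for $L\subset R$, $L^H_K=L\cap R^H_K$. $\mathbb P(R)$ is the set of subsets of $R$ whose induced subgraph is isomorphic to $R$. A labeling of $L\in\mathbb P(R)$ is a partition $\{L_n:n\in\omega\}$ of $L$ together with a bijection $(n,K)\mapsto q^{\bigcup_{i<n}L_i}_K$ from $\bigcup_n\{n\}\times P(\bigcup_{i<n}L_i)$ onto $L$ with $L_n=\{q^{\bigcup_{i<n}L_i}_K:K\subset\bigcup_{i<n}L_i\}$ and $q^{\bigcup_{i<n}L_i}_K\in L^{\bigcup_{i<n}L_i}_K$. The order induced by a labeling is $q^{\bigcup_{i<m}L_i}_{K'}\le_L q^{\bigcup_{i<n}L_i}_{K''}$ iff $L^{\bigcup_{i<m}L_i}_{K'}\subset L^{\bigcup_{i<n}L_i}_{K''}$; $\langle L,\le_L\rangle$ is a reversed tree (reverse of a tree) with largest element and $n$-th level $L_n$; $(-\infty,q]=\{p:p\le q\}$. A subset $\mathcal S$ of a reversed tree $T$ of height $\omega$ is a strong reversed subtree iff: (1) $\mathcal S$ has a unique largest element; (2) there is $n_0<n_1<\dots$ with $\emptyset\ne\mathrm{Lev}_k(\mathcal S)\subset\mathrm{Lev}_{n_k}(T)$ for all $k$; (3) if $s\in\mathrm{Lev}_k(\mathcal S)$ then for each immediate predecessor $t$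 of $s$ in $T$ there is a unique $s_t\in\mathrm{Lev}_{k+1}(\mathcal S)$ with $s_t\le t$. *)

(* Defs.v *)
From mathcomp Require Import all_boot.
From mathcomp Require Import boolp classical_sets functions cardinality.

Set Implicit Arguments.
Unset Strict Implicit.
Unset Printing Implicit Defensive.

Local Open Scope classical_set_scope.

Section Graphs.
Variables (V : Type) (e : V -> V -> Prop).
Implicit Types (L H K : set V).

(* [ext L H K] is L^H_K, and R^H_K is [ext setT H K]. *)
Definition ext L H K : set V :=
  [set v | [/\ L v, ~ H v, forall k, K k -> e v k
             & forall h, H h -> ~ K h -> ~ e v h]].

Definition simple_graph : Prop :=
  (forall x, ~ e x x) /\ (forall x y, e x y -> e y x).

Definition rado_graph : Prop :=
  [/\ simple_graph, countable [set: V]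
    & forall H K, finite_set H -> K `<=` H -> ext setT H K !=set0].

(* The copies of the graph inside itself, i.e., P(R). *)
Definition copies : set (set V) :=
  [set L | exists f : V -> V,
     set_bij setT L f /\ forall x y, e x y <-> e (f x) (f y)].

Definition below (L_ : nat -> set V) (n : nat) : set V := \bigcup_(i < n) L_ i.

Definition partition_of L (L_ : nat -> set V) : Prop :=
  [/\ forall n, L_ n !=set0, trivIset setT L_ & \bigcup_n L_ n = L].

(* [q n K] is the label q^{below L_ n}_K; its values are relevant only when
   K `<=` below L_ n. *)
Record labeling L (L_ : nat -> set V) (q : nat -> set V -> V) : Prop := Labeling {
  labeling_partition : partition_of L L_;
  labeling_bij : set_bij [set nK : nat * set V | nK.2 `<=` below L_ nK.1] L
                   (fun nK => q nK.1 nK.2);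
  labeling_level : forall n, L_ n = q n @` [set K | K `<=` below L_ n];
  labeling_ext : forall n K, K `<=` below L_ n -> ext L (below L_ n) K (q n K)
}.

Definition label_le L (L_ : nat -> set V) (q : nat -> set V -> V) (x y : V) : Prop :=
  exists m K' n K'',
    [/\ K' `<=` below L_ m, K'' `<=` below L_ n, x = q m K', y = q n K''
      & ext L (below L_ m) K' `<=` ext L (below L_ n) K''].

End Graphs.

Section ReversedTrees.
Variables (V : Type) (le : V -> V -> Prop).
Implicit Types (T S : set V) (s t x y : V).

Definition slt x y : Prop := le x y /\ x <> y.

(* (-oo, x] in the suborder T. *)
Definition downset T x : set V := [set y | T y /\ le y x].

Definition strict_upset T x : set V := [set y | T y /\ slt x y].

(* The n-th level of the reversed tree T: the points whose strict upset in T,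
   read in the reverse order, has order type n. *)
Definition lev T (n : nat) : set V :=
  [set x | T x /\ exists f : nat -> V,
     set_bij `I_n (strict_upset T x) f /\
     forall i j, (i < n)%N -> (j < n)%N -> ((i <= j)%N <-> le (f j) (f i))].

Definition largest S x : Prop := S x /\ forall y, S y -> le y x.

Definition immediate_pred T s t : Prop :=
  [/\ T t, slt t s & ~ exists u, [/\ T u, slt t u & slt u s]].

Definition strong_reversed_subtree T S : Prop :=
  [/\ S `<=` T,
      exists! x, largest S x,
      exists n_ : nat -> nat, (forall k, (n_ k < n_ k.+1)%N) /\
        forall k, lev S k !=set0 /\ lev S k `<=` lev T (n_ k)
    & forall k s, lev S k s -> forall t, immediate_pred T s t ->
        exists! s', lev S k.+1 s' /\ le s' t].

End ReversedTrees.

(* Main.v *)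
(* In a labeling the points x <= y are exactly those for which x lies outside
   the levels before that of y and has there the same neighbours as y.  Hence an
   immediate predecessor of a point s of level n keeps the neighbours of s before
   level n and has an arbitrary, prescribed trace on level n.  Starting from the
   root of S, the label p k+1 H is the point of the (k+1)-st level of S found
   below the immediate predecessor of p k (H minus the k-th level) whose trace on
   level n_k is that of H.  The resulting set has the extension property, so it is
   a copy of the Rado graph by back-and-forth. *)
Require Import Defs.
From mathcomp Require Import all_boot.
From mathcomp Require Import boolp classical_sets functions cardinality.

Set Implicit Arguments.
Unset Strict Implicit.

Local Open Scope classical_set_scope.

(** * Back-and-forth between countable sets with the extension property *)

Section BackAndForth.
Variables (V : Type) (e : V -> V -> Prop).
Implicit Types (A B : set V) (R : set (V * V)).

Definition extension_property A : Prop :=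
  forall H K, finite_set H -> H `<=` A -> K `<=` H -> ext e A H K !=set0.

(** A partial isomorphism is kept as its graph; the equivalence of the two equalities makes it
    single-valued and injective at once. *)
Definition finite_partial_iso A B R : Prop :=
  [/\ finite_set R,
      forall a, R a -> A a.1 /\ B a.2
    & forall a b, R a -> R b ->
        (a.1 = b.1 <-> a.2 = b.2) /\ (e a.1 b.1 <-> e a.2 b.2)].

Hypothesis e_simple : simple_graph e.

(** If [x] is not yet in the domain, its image is a witness in [B] joined, within the range of [R],
    exactly to the images of the neighbours of [x]. *)
Lemma partial_iso_forth A B R x :
  extension_property B -> finite_partial_iso A B R -> A x ->
  exists R', [/\ finite_partial_iso A B R', R `<=` R' & exists y, R' (x, y)].
Proof.
have [e_irr e_sym] := e_simple.
move=> extB isoR Ax; have [Rfin RAB Riso] := isoR.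
have [[y Rxy]|xR] := pselect (exists y, R (x, y)).
  by exists R; split=> //; exists y.
have HB : snd @` R `<=` B by move=> _ [a /RAB[_ Ba] <-].
have KH : snd @` (R `&` [set a | e x a.1]) `<=` snd @` R.
  by move=> _ [a [Ra _] <-]; exists a.
have [y [By yH yK yHK]] := extB _ _ (finite_image snd Rfin) HB KH.
have xy a : R a -> (x = a.1 <-> y = a.2) /\ (e x a.1 <-> e y a.2).
  move=> Ra; split; split.
  - by move=> xa; case: xR; exists a.2; rewrite xa -surjective_pairing.
  - by move=> ya; case: yH; exists a.
  - by move=> exa; apply: yK; exists a.
  - move=> eya; apply: contrapT => nexa.
    apply: yHK eya; first by exists a.
    (* Another pair [b] could make [a.2] a prescribed neighbour; injectivity of [R] forces
       [b.1 = a.1]. *)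
    move=> [b [Rb exb] ba]; apply: nexa.
    by have [[_ <-]] := Riso _ _ Rb Ra.
exists ((x, y) |` R); split; last 2 first.
- exact: subsetUr.
- by exists y; left.
split.
- by rewrite finite_setU; split.
- by move=> a [->|/RAB].
- move=> a b [->|Ra] [->|Rb] /=.
  + by split=> //; split=> /e_irr.
  + exact: xy.
  + have [xa exa] := xy _ Ra; split; split.
    * by move=> ax; apply/esym/xa.
    * by move=> ay; apply/esym/xa.
    * by move=> /e_sym/exa/e_sym.
    * by move=> /e_sym/exa/e_sym.
  + exact: Riso.
Qed.

Lemma partial_iso_swap A B R :
  finite_partial_iso A B R -> finite_partial_iso B A [set a | R (a.2, a.1)].
Proof.
move=> [Rfin RAB Riso]; split.
- apply: sub_finite_set (finite_image (fun a => (a.2, a.1)) Rfin).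
  by move=> [x y] /= Ryx; exists (y, x).
- by move=> a /RAB[].
- by move=> a b Ra Rb; have [/= -> ->] := Riso _ _ Ra Rb.
Qed.

Lemma partial_iso_back A B R y :
  extension_property A -> finite_partial_iso A B R -> B y ->
  exists R', [/\ finite_partial_iso A B R', R `<=` R' & exists x, R' (x, y)].
Proof.
move=> extA /partial_iso_swap isoR By.
have [R' [isoR' RR' [x R'yx]]] := partial_iso_forth extA isoR By.
exists [set a | R' (a.2, a.1)]; split.
- exact: partial_iso_swap.
- by move=> [u v] Ruv; apply: RR'.
- by exists x.
Qed.

(** Stage [n] puts the vertex of code [n] into the domain if it lies in [A] and into the range if it
    lies in [B]; the union of the stages is the graph of the isomorphism. *)
Lemma extension_property_iso A B :
  countable [set: V] -> extension_property A -> extension_property B ->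
  exists f, set_bij A B f /\
    forall x y, A x -> A y -> (e x y <-> e (f x) (f y)).
Proof.
move=> /countable_injP[c c_inj] extA extB.
have {}c_inj x y : c x = c y -> x = y by apply: c_inj; rewrite in_setE.
pose good := finite_partial_iso A B.
(* The premise [good] sits under the existential so that [choice] yields a total step function. *)
have next_ex (nR : nat * set (V * V)) : exists R', good nR.2 ->
    [/\ good R', nR.2 `<=` R',
        forall x, c x = nR.1 -> A x -> exists y, R' (x, y)
      & forall y, c y = nR.1 -> B y -> exists x, R' (x, y)].
  case: nR => n R /=.
  have [isoR|] := pselect (good R); last by move=> nR; exists R.
  have [[x <-]|nx] := pselect (exists x, c x = n); last first.
    by exists R => _; split=> // x cx; case: nx; exists x.
  have [R1 [iso1 sub1 R1x]] : exists R1,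
      [/\ good R1, R `<=` R1 & A x -> exists y, R1 (x, y)].
    have [/(partial_iso_forth extB isoR)[R1 [? ? ?]]|nAx] := pselect (A x).
      by exists R1; split.
    by exists R; split.
  have [R2 [iso2 sub2 R2x]] : exists R2,
      [/\ good R2, R1 `<=` R2 & B x -> exists y, R2 (y, x)].
    have [/(partial_iso_back extA iso1)[R2 [? ? ?]]|nBx] := pselect (B x).
      by exists R2; split.
    by exists R1; split.
  exists R2 => _; split=> //.
  - exact: subset_trans sub2.
  - by move=> z /c_inj-> /R1x[y /sub2]; exists y.
  - by move=> z /c_inj->.
have [next nextP] := choice next_ex.
pose R_ := fix R_ n := if n is n'.+1 then next (n', R_ n') else set0.
have R_good n : good (R_ n).
  elim: n => [|n IHn]; first by split=> //; exact: finite_set0.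
  by have [] := nextP (n, R_ n) IHn.
have R_mono m n : (m <= n)%N -> R_ m `<=` R_ n.
  elim: n => [|n IHn]; first by rewrite leqn0 => /eqP->.
  rewrite leq_eqVlt => /predU1P[->//|/IHn mn].
  by apply: subset_trans mn _; have [] := nextP (n, R_ n) (R_good n).
(* Pairs from different stages are compared inside the later stage. *)
have R_iso m n a b : R_ m a -> R_ n b ->
    (a.1 = b.1 <-> a.2 = b.2) /\ (e a.1 b.1 <-> e a.2 b.2).
  move=> Ra Rb; have [_ _] := R_good (maxn m n); apply.
  - by apply: R_mono Ra; rewrite leq_maxl.
  - by apply: R_mono Rb; rewrite leq_maxr.
have f_ex x : exists y, A x -> exists n, R_ n (x, y).
  have [Ax|] := pselect (A x); last by exists x.
  have [_ _ /(_ x erefl Ax)[y Rxy] _] := nextP (c x, R_ (c x)) (R_good _).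
  by exists y => _; exists (c x).+1.
have [f fP] := choice f_ex.
exists f; split; first split.
- by move=> x /fP[n Rn]; have [_ /(_ _ Rn)[]] := R_good n.
- move=> x y; rewrite !in_setE => /fP[m Rm] /fP[n Rn] fxy.
  by have [[_ xy] _] := R_iso _ _ _ _ Rm Rn; exact: xy.
- move=> y By.
  have [_ _ _ /(_ y erefl By)[x Rxy]] := nextP (c y, R_ (c y)) (R_good _).
  have Ax : A x by have [_ /(_ _ Rxy)[]] := R_good (c y).+1.
  exists x => //; have [n Rn] := fP _ Ax.
  by have [[xy _] _] := R_iso _ (c y).+1 _ (x, y) Rn Rxy; apply: xy.
- by move=> x y /fP[m Rm] /fP[n Rn]; have [_] := R_iso _ _ _ _ Rm Rn.
Qed.

End BackAndForth.

(** * Extension sets as traces, and initial unions of levels *)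

Section Ext.
Context {V : Type} {e : V -> V -> Prop}.

(** For [K] inside [H] the two adjacency clauses merge into one: the trace of [v] on [H] is [K]. *)
Lemma extE {L H K : set V} {v} : K `<=` H ->
  ext e L H K v <-> [/\ L v, ~ H v & forall h, H h -> (e v h <-> K h)].
Proof.
move=> KH; split=> [[Lv nHv vK vHK]|[Lv nHv vHK]]; split=> //.
- move=> h Hh; split=> [evh|/vK//].
  by apply: contrapT => nKh; apply: vHK evh.
- by move=> k Kk; apply/vHK => //; apply: KH.
- by move=> h Hh nKh /vHK -/(_ Hh).
Qed.

Lemma belowS (L_ : nat -> set V) n : below L_ n.+1 = below L_ n `|` L_ n.
Proof.
apply/seteqP; split=> x.
- move=> [i /=]; rewrite ltnS leq_eqVlt => /predU1P[->|lt_in] Lx; first by right.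
  by left; exists i.
- by case=> [[i /= lt_in Lx]|Lx]; [exists i => //=; exact: ltnW | exists n => /=].
Qed.

Lemma below_mono (L_ : nat -> set V) m n :
  (m <= n)%N -> below L_ m `<=` below L_ n.
Proof. by move=> mn x [i /= im Lx]; exists i => //=; exact: leq_trans mn. Qed.

Lemma level_sub_below (L_ : nat -> set V) m n :
  (m < n)%N -> L_ m `<=` below L_ n.
Proof. by move=> mn x Lx; exists m. Qed.

End Ext.

(** * The order induced by a labeling *)

Section LabelOrder.
Variables (V : Type) (e : V -> V -> Prop) (L : set V).
Variables (L_ : nat -> set V) (q : nat -> set V -> V).
Hypothesis Lq : labeling e L L_ q.

Local Notation B := (below L_).
Local Notation le := (label_le e L L_ q).

Lemma label_level n K : K `<=` B n -> L_ n (q n K).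
Proof. by move=> KB; rewrite (labeling_level Lq); exists K. Qed.

Lemma level_labelP n x : L_ n x -> exists2 K, K `<=` B n & x = q n K.
Proof. by rewrite (labeling_level Lq) => -[K KB <-]; exists K. Qed.

Lemma level_sub n : L_ n `<=` L.
Proof. by have [_ _ <-] := labeling_partition Lq; exact: bigcup_sup. Qed.

Lemma levelP x : L x -> exists n, L_ n x.
Proof. by have [_ _ <-] := labeling_partition Lq; move=> [n _]; exists n. Qed.

Lemma level_inj m n x : L_ m x -> L_ n x -> m = n.
Proof.
have [_ triv _] := labeling_partition Lq => Lm Ln.
by apply: triv => //; exists x.
Qed.

Lemma level_not_below n x : L_ n x -> ~ B n x.
Proof.
by move=> Ln [m /= mn /(level_inj Ln) nm]; rewrite nm ltnn in mn.
Qed.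

Lemma label_adj n K z : K `<=` B n -> B n z -> (e (q n K) z <-> K z).
Proof. by move=> KB Bz; have /extE[] := labeling_ext Lq KB; auto. Qed.

Lemma level_ge m n x : L_ m x -> ~ B n x -> (n <= m)%N.
Proof.
by move=> Lx nB; rewrite leqNgt; apply/negP => mn; apply: nB; exists m.
Qed.

(** Forwards, [x] lies in the extension set of its own label. Backwards, the trace that labels [x]
    restricts to the one that labels [y], so the extension sets are nested. *)
Lemma label_leE {n x y} : L_ n y ->
  le x y <-> [/\ L x, ~ B n x & forall z, B n z -> (e x z <-> e y z)].
Proof.
move=> Ly; split.
- move=> [m [K' [n' [K [K'B KB xE yE sub]]]]].
  have nn' : n' = n.
    by apply: (@level_inj _ _ y) => //; rewrite yE; exact: label_level.
  rewrite {}nn' in KB yE sub.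
  have /(extE KB)[Lx nBx xK] : ext e L (B n) K x.
    by rewrite xE; apply: sub; exact: (labeling_ext Lq).
  split=> // z Bz; rewrite yE label_adj //; exact: xK.
- move=> [Lx nBx xy]; have [m Lm] := levelP Lx.
  have nm := level_ge Lm nBx.
  have [K' K'B xE] := level_labelP Lm.
  have [K KB yE] := level_labelP Ly.
  exists m, K', n, K; split=> // v /(extE K'B)[Lv nBv vK'].
  apply/extE => //; split=> //; first by move=> Bv; apply: nBv; exact: below_mono Bv.
  move=> z Bz; have Bmz := below_mono nm Bz.
  by rewrite vK' // -(@label_adj m) // -xE xy // yE label_adj.
Qed.

Lemma ext_label n K : K `<=` B n -> ext e L (B n) K = downset le L (q n K).
Proof.
move=> KB; apply/seteqP; split=> x.
- move=> /extE -/(_ KB)[Lx nBx xK]; split=> //.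
  apply/(@label_leE n); first exact: label_level.
  by split=> // z Bz; rewrite label_adj //; exact: xK.
- move=> [_ /(label_leE (label_level KB))[Lx nBx xq]].
  by apply/extE => //; split=> // z Bz; rewrite xq // label_adj.
Qed.

Lemma label_le_refl x : L x -> le x x.
Proof.
move=> Lx; have [n Ln] := levelP Lx.
by apply/(@label_leE n) => //; split=> //; exact: level_not_below.
Qed.

Lemma label_le_trans x y z : L y -> L z -> le x y -> le y z -> le x z.
Proof.
move=> Ly Lz; have [m Lm] := levelP Ly; have [n Ln] := levelP Lz.
move=> /(label_leE Lm)[Lx nBx xy] /(label_leE Ln)[_ nBy yz].
have nm := below_mono (L_ := L_) (level_ge Lm nBy).
apply/(@label_leE n) => //; split=> //; first by move/nm.
by move=> w Bw; rewrite xy; [exact: yz | exact: nm].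
Qed.

(** A point of a level is determined by its trace on the earlier levels, and comparability makes
    these traces agree. *)
Lemma label_le_same_level n x y : L_ n x -> L_ n y -> le x y -> x = y.
Proof.
move=> Lx Ly /(label_leE Ly)[_ _ xy].
have [K KB xE] := level_labelP Lx; have [K' KB' yE] := level_labelP Ly.
rewrite xE yE; congr q; apply/seteqP; split=> z Kz.
- by apply/(@label_adj n) => //; [exact: KB | rewrite -yE -xy ?xE ?label_adj //; exact: KB].
- by apply/(@label_adj n) => //; [exact: KB' | rewrite -xE xy ?yE ?label_adj //; exact: KB'].
Qed.

(** Above a point of [L_ m] lies exactly one point of each earlier level, so its strict upset has
    [m] elements; comparing cardinalities gives [n = m]. *)
Lemma lev_sub_level n : lev le L n `<=` L_ n.
Proof.
move=> x [Lx [f [f_bij _]]]; have [m Lm] := levelP Lx.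
(* The label of the trace of [x] before level [j], hence the only possible point of level [j] above
   [x]. *)
pose up j := q j ([set z | e x z] `&` B j).
have upL j : L_ j (up j) by apply: label_level; exact: subIsetr.
have x_up j : (j <= m)%N -> le x (up j).
  move=> jm; apply/(@label_leE j) => //; split=> //.
    by move=> Bx; apply: (level_not_below Lm); exact: below_mono Bx.
  by move=> z Bz; rewrite label_adj //=; split=> // -[].
have up_bij : set_bij `I_m (strict_upset le L x) up.
  split.
  - move=> j /= jm; split; first exact: level_sub (upL j).
    split; first exact: x_up (ltnW jm).
    by move=> xE; move: jm; rewrite (level_inj Lm (_ : L_ j x)) ?ltnn // xE.
  - move=> i j _ _ ij; apply: level_inj (upL i) _; rewrite ij; exact: upL.
  - move=> y [Ly [xy nxy]]; have [j Lj] := levelP Ly.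
    have [_ nBx _] := (label_leE Lj).1 xy.
    have jm := level_ge Lm nBx; exists j => /=.
      rewrite ltn_neqAle jm andbT; apply/eqP => jE.
      by apply: nxy; apply: (@label_le_same_level m) => //; rewrite -jE.
    apply: (@label_le_same_level j) => //; apply/(@label_leE j) => //; split.
    + exact: level_sub (upL j).
    + exact: level_not_below.
    + have /(label_leE (upL j))[_ _ xup] := x_up _ jm.
      have /(label_leE Lj)[_ _ xy'] := xy.
      by move=> z Bz; rewrite -xup // xy'.
suff -> : n = m by [].
apply/card_eq_II/(card_eq_trans (pcard_eq f_bij))/card_esym.
exact: pcard_eq up_bij.
Qed.

(* The sets H are unrestricted here: intersecting with [B (n_ k)] rather than
   with the union of the first k levels of the new labeling, which agrees with
   it on the relevant H, lets p be defined before those levels. *)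
Lemma strong_subtree_labels S : strong_reversed_subtree le L S ->
  exists (n_ : nat -> nat) (p : nat -> set V -> V), [/\
    forall k, (n_ k < n_ k.+1)%N,
    forall k H, S (p k H) /\ L_ (n_ k) (p k H),
    forall k H, le (p k.+1 H) (p k (H `&` B (n_ k)))
  & forall k H z, L_ (n_ k) z -> (e (p k.+1 H) z <-> H z)].
Proof.
move=> [_ _ [n_ [n_incr levS]] succS].
have [r r_root] := (levS 0).1.
have lev_level k : lev le S k `<=` L_ (n_ k).
  by apply: subset_trans (levS k).2 _; exact: lev_sub_level.
have step_ex (a : nat * V * set V) : exists s', lev le S a.1.1 a.1.2 ->
    [/\ lev le S a.1.1.+1 s', le s' a.1.2
      & forall z, L_ (n_ a.1.1) z -> (e s' z <-> a.2 z)].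
  case: a => [[k s] X] /=.
  have [ks|] := pselect (lev le S k s); last by exists s.
  have Ls := lev_level _ _ ks.
  (* The trace of [s] before level [n_ k], with [X] prescribed on that level. *)
  pose K := ([set z | e s z] `&` B (n_ k)) `|` (X `&` L_ (n_ k)).
  have KB : K `<=` B (n_ k).+1.
    by rewrite belowS => z [[]|[]]; [left|right].
  have Lt := label_level KB.
  have ts : le (q (n_ k).+1 K) s.
    apply/(label_leE Ls); split; first exact: level_sub Lt.
    - by move=> Bt; apply: (level_not_below Lt); exact: below_mono Bt.
    - move=> z Bz; rewrite label_adj //; last by rewrite belowS; left.
      split=> [[[]//|[_ /level_not_below]//]|esz]; by left.
  have t_pred : immediate_pred le L s (q (n_ k).+1 K).
    split; first exact: level_sub Lt.
    - split=> // tE; rewrite tE in Lt.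
      by have /eqP := level_inj Lt Ls; rewrite eqn_leq ltnn.
    (* A point in between would lie on one of the two consecutive levels of [s] and its predecessor,
       hence coincide with one of them. *)
    - move=> [u [Lu [tu ntu] [us nus]]]; have [m Lm] := levelP Lu.
      have [_ nBt _] := (label_leE Lm).1 tu.
      have [_ nBu _] := (label_leE Ls).1 us.
      have := level_ge Lt nBt; rewrite leq_eqVlt => /predU1P[mE|].
        by apply: ntu; apply: (label_le_same_level Lt) => //; rewrite -mE.
      rewrite ltnS => mk; apply: nus; apply: (label_le_same_level (n := n_ k)) => //.
      suff <- : m = n_ k by [].
      by apply/eqP; rewrite eqn_leq mk (level_ge Lm nBu).
  have [s' [[ks' s't] _]] := succS _ _ ks _ t_pred.
  exists s' => _; split=> //.
  - apply: label_le_trans s't ts; first exact: level_sub Lt.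
    exact: level_sub Ls.
  - have [_ _ s'K] := (label_leE Lt).1 s't.
    move=> z Lz; have Bz : B (n_ k).+1 z by rewrite belowS; right.
    rewrite s'K // label_adj //; split=> [[[_]|[]//]|Xz]; last by right.
    by move/(level_not_below Lz).
have [step stepP] := choice step_ex.
(* The value at 0 is the root for every [H]; only the empty set is a relevant index there. *)
pose p := fix p k H :=
  if k is k'.+1 then step (k', p k' (H `&` B (n_ k')), H) else r.
have p_lev k H : lev le S k (p k H).
  elim: k H => [//|k IHk] H.
  by have [] := stepP (k, p k (H `&` B (n_ k)), H) (IHk _).
exists n_, p; split=> // k H.
- by split; [have [] := p_lev k H | exact: lev_level].
- by have [] := stepP (k, p k (H `&` B (n_ k)), H) (p_lev _ _).
- by have [] := stepP (k, p k (H `&` B (n_ k)), H) (p_lev _ _).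
Qed.

End LabelOrder.

(** * The labeling formed by the chosen points [p k H] *)

Section Sublabeling.
Variables (V : Type) (e : V -> V -> Prop) (L : set V).
Variables (L_ : nat -> set V) (q : nat -> set V -> V).
Hypothesis Lq : labeling e L L_ q.
Variables (n_ : nat -> nat) (p : nat -> set V -> V).

Local Notation B k := (below L_ (n_ k)).
Local Notation le := (label_le e L L_ q).

Hypothesis n_incr : forall k, (n_ k < n_ k.+1)%N.
Hypothesis p_level : forall k H, L_ (n_ k) (p k H).
Hypothesis p_le : forall k H, le (p k.+1 H) (p k (H `&` B k)).
Hypothesis p_adj : forall k H z, L_ (n_ k) z -> (e (p k.+1 H) z <-> H z).

(** The union of the first [k] new levels, built by recursion because each new level is indexed by
    the subsets of that union. *)
Fixpoint sublabel_below (k : nat) : set V :=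
  if k is k'.+1 then
    sublabel_below k' `|` p k' @` [set H | H `<=` sublabel_below k']
  else set0.

Local Notation C := sublabel_below.

Definition sublabel_level (k : nat) : set V := p k @` [set H | H `<=` C k].

Definition sublabel_set : set V := \bigcup_k sublabel_level k.

Local Notation M_ := sublabel_level.
Local Notation M := sublabel_set.

Lemma below_sublabel k : below M_ k = C k.
Proof.
elim: k => [|k IHk]; last by rewrite belowS IHk.
by apply/seteqP; split=> x // [].
Qed.

Lemma sublabel_level_sub k : M_ k `<=` L_ (n_ k).
Proof. by move=> _ [H _ <-]. Qed.

Lemma sublabel_below_sub k : C k `<=` B k.
Proof.
elim: k => [//|k IHk] z [/IHk|/sublabel_level_sub].
- by apply: below_mono; exact: ltnW.
- exact: level_sub_below.
Qed.

(** Cutting with [B k] removes the new level [k], which lies in [L_ (n_ k)]; so the recursion for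
    [p] stays among relevant indices. *)
Lemma sublabel_belowI k H : H `<=` C k.+1 -> H `&` B k `<=` C k.
Proof.
move=> HC z [/HC[//|/sublabel_level_sub Lz] Bz].
by case: (level_not_below Lq Lz).
Qed.

Lemma sublabel_below_mono j k : (j <= k)%N -> C j `<=` C k.
Proof. by rewrite -!below_sublabel; exact: below_mono. Qed.

(** On the last level the trace is prescribed by [p_adj]; on earlier levels it is inherited from the
    point above, by [p_le] and induction. *)
Lemma sublabel_adj k H z : H `<=` C k -> C k z -> (e (p k H) z <-> H z).
Proof.
elim: k H => [//|k IHk] H HC [Cz|/sublabel_level_sub]; last exact: p_adj.
have Bz := sublabel_below_sub Cz.
have [_ _ pz] := (label_leE Lq (p_level k _)).1 (p_le k H).
rewrite pz // IHk //; last exact: sublabel_belowI.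
by split=> // -[].
Qed.

Lemma n_inj : injective n_.
Proof.
apply: incn_inj; apply: leq_mono; apply: homo_ltn n_incr; exact: ltn_trans.
Qed.

(** Distinct new levels lie in distinct levels of [L], and within a level the index [H] is recovered
    as the trace of [p k H] on [C k]. *)
Lemma sublabel_labeling : labeling e M M_ p.
Proof.
split.
- split=> //.
  + by move=> k; exists (p k set0); exists set0 => //; exact: sub0set.
  + move=> j k _ _ [x [/sublabel_level_sub xj /sublabel_level_sub xk]].
    exact: n_inj (level_inj Lq xj xk).
- split.
  + by move=> [k H] /=; rewrite below_sublabel => HC; exists k => //; exists H.
  + move=> [k H] [k' H']; rewrite !in_setE /= !below_sublabel => HC HC' pE.
    have kk' : k = k'.
      by apply/n_inj/(level_inj Lq (p_level k H)); rewrite pE; exact: p_level.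
    rewrite -{}kk' in HC' pE *; congr pair; apply/seteqP; split=> z Hz.
    * by apply/(sublabel_adj HC' (HC _ Hz)); rewrite -pE sublabel_adj //; exact: HC.
    * by apply/(sublabel_adj HC (HC' _ Hz)); rewrite pE sublabel_adj //; exact: HC'.
  + move=> _ [k _ [H HC <-]]; exists (k, H) => //=.
    by rewrite below_sublabel.
- by move=> k; rewrite below_sublabel.
- move=> k H; rewrite below_sublabel => HC; apply/extE => //; split.
  + by exists k => //; exists H.
  + by move=> /sublabel_below_sub; exact: (level_not_below Lq).
  + by move=> z; exact: sublabel_adj.
Qed.

(** Iterating [p_le] climbs to level [j], each step cutting one level off [H]. *)
Lemma sublabel_le j k H : (j <= k)%N -> H `<=` C k ->
  le (p k H) (p j (H `&` C j)).
Proof.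
elim: k H => [|k IHk] H.
  rewrite leqn0 => /eqP-> /setIidl->.
  by apply: (label_le_refl Lq); exact: (level_sub Lq (p_level _ _)).
rewrite leq_eqVlt => /predU1P[-> /setIidl->|].
  by apply: (label_le_refl Lq); exact: (level_sub Lq (p_level _ _)).
rewrite ltnS => jk HC.
have -> : H `&` C j = (H `&` B k) `&` C j.
  rewrite -setIA [B k `&` _]setIC [C j `&` _]setIidl //.
  by move=> z Cz; exact: sublabel_below_sub (sublabel_below_mono jk Cz).
apply: (label_le_trans Lq) (p_le k H) (IHk _ jk (sublabel_belowI HC)).
- exact: (level_sub Lq (p_level _ _)).
- exact: (level_sub Lq (p_level _ _)).
Qed.

(** Forwards, agreement on [C j] makes the index of [y] the restriction of that of [x], so
    [sublabel_le] applies. Backwards, agreement on [B j] implies agreement on its subset [C j]. *)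
Lemma sublabel_leE x y : M x -> M y -> (label_le e M M_ p x y <-> le x y).
Proof.
move=> [k _ [H HC xE]] [j _ Mj]; have [H' HC' yE] := Mj.
have Ly : L_ (n_ j) y by exact: sublabel_level_sub Mj.
split.
- move=> /(label_leE sublabel_labeling Mj); rewrite below_sublabel.
  move=> [_ nCx xy].
  have jk : (j <= k)%N.
    rewrite leqNgt; apply/negP => kj; apply: nCx; rewrite -below_sublabel.
    by exists k => //; exists H.
  rewrite -xE -yE (_ : H' = H `&` C j); first exact: sublabel_le.
  apply/seteqP; split=> z.
  + move=> H'z; have Cz := HC' _ H'z; split=> //.
    apply/(sublabel_adj HC (sublabel_below_mono jk Cz)).
    by rewrite xE xy // -yE sublabel_adj.
  + move=> [Hz Cz]; apply/(sublabel_adj HC' Cz); rewrite yE -xy // -xE.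
    by rewrite sublabel_adj //; exact: HC.
- move=> /(label_leE Lq Ly)[_ nBx xy].
  apply/(label_leE sublabel_labeling Mj); rewrite below_sublabel; split.
  + by exists k => //; exists H.
  + by move=> /sublabel_below_sub.
  + by move=> z /sublabel_below_sub; exact: xy.
Qed.

End Sublabeling.

(** * The extension property of labeled sets, and the conclusion *)

Lemma labeling_extension_property (V : Type) (e : V -> V -> Prop) L L_ q :
  labeling e L L_ q -> extension_property e L.
Proof.
move=> Lq H K Hfin HL KH.
have [n HB] : exists n, H `<=` below L_ n.
  have [l lP] : {l : V -> nat & forall x, L x -> L_ (l x) x}.
    apply: (@choice _ _ (fun x n => L x -> L_ n x)) => x.
    have [/(levelP Lq)[n Ln]|] := pselect (L x); first by exists n.
    by exists 0%N.
  have /finite_seqP[s lE] := finite_image l Hfin.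
  (* The finite set [H] meets finitely many levels; the successor is taken since [below] excludes
     the level of its index. *)
  exists (\max_(i <- s) i).+1 => x Hx; exists (l x) => /=; last exact/lP/HL.
  rewrite ltnS; apply: (leq_bigmax_seq (F := id)) => //.
  by have : (l @` H) (l x) by [exists x]; rewrite lE.
have KB := subset_trans KH HB; exists (q n K).
have /extE -/(_ KB)[Lqn nBq qK] := labeling_ext Lq KB.
apply/extE => //; split=> //; first by move=> /HB.
by move=> h /HB; exact: qK.
Qed.

Unset Implicit Arguments.

Theorem theorem9p3 (V : Type) (e : V -> V -> Prop) (L : set V)
    (L_ : nat -> set V) (q : nat -> set V -> V) (S : set V) :
  rado_graph e ->
  copies e L ->
  labeling e L L_ q ->
  strong_reversed_subtree (label_le e L L_ q) L S ->
  exists (M : set V) (M_ : nat -> set V) (p : nat -> set V -> V),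
    [/\ copies e M,
        M `<=` S,
        labeling e M M_ p,
        forall x y, M x -> M y ->
          (label_le e M M_ p x y <-> label_le e L L_ q x y)
      & forall k H, H `<=` below M_ k ->
          ext e M (below M_ k) H = downset (label_le e M M_ p) M (p k H) /\
          downset (label_le e M M_ p) M (p k H)
            = M `&` downset (label_le e L L_ q) L (p k H)].
Proof.
move=> [e_simple Vcount eR] _ Lq /(strong_subtree_labels Lq).
move=> [n_ [p [n_incr p_S p_le p_adj]]].
have p_level k H : L_ (n_ k) (p k H) := (p_S k H).2.
have Mp := sublabel_labeling Lq n_incr p_level p_le p_adj.
have M_le := sublabel_leE Lq n_incr p_level p_le p_adj.
have extV : extension_property e setT by move=> H K Hfin _; exact: eR.
exists (sublabel_set p), (sublabel_level p), p; split=> //.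
- have extM := labeling_extension_property Mp.
  (* Back-and-forth from the whole vertex set onto the new set gives the embedding that [copies]
     asks for. *)
  have [f [f_bij f_iso]] := extension_property_iso e_simple Vcount extV extM.
  by exists f; split=> // x y; exact: f_iso.
- by move=> _ [k _ [H _ <-]]; have [] := p_S k H.
- move=> k H HC; split; first exact: ext_label.
  have Mpk : sublabel_set p (p k H).
    by apply: (level_sub Mp); exact: (label_level Mp).
  apply/seteqP; split=> x [Mx].
  + move=> /(M_le _ _ Mx Mpk) xp; do 2!split=> //.
    by move: Mx => [j _ [H' _ <-]]; exact: (level_sub Lq (p_level _ _)).
  + by move=> [_ /(M_le _ _ Mx Mpk)].
Qed.
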